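(* Any distributed delay cannot be approximated in the graph topology by a purely atomic distribution; that is, for all reals $0\le\vartheta_1<\vartheta_2$ and every $g\in\mathscr{K}([\vartheta_1,\vartheta_2])$, it is not the case that for every $\varepsilon>0$ there exists a purely atomic distribution $p\in\mathscr{A}$ with $\|g-p\|_{\mathscr{A}}\le\varepsilon$.
   Context: $\mathscr{A}$ is the set of distributions supported on $[0,\infty)$ of the form $f=f_a+\sum_{n\ge 0}f_n\delta(t-t_n)$, with $f_a\in\mathscr{L}_1(\mathbb{R}_+)$ complex valued, $f_n\in\mathbb{C}$, $0=t_0<t_1<t_2<\dots$, $\sum_n|f_n|<\infty$, and $\delta(t-t_n)$ the Dirac distribution at $t_n$. It is a commutative Banach algebra under convolution, with unit $\delta$ and norm $\|f\|_{\mathscr{A}}=\|f_a\|_{\mathscr{L}_1}+\sum_{n}|f_n|$. A purely atomic distribution is an element $p=\sum_{i\ge 0}p_i\delta(t-t_i)$ of $\mathscr{A}$ with $\sum_i|p_i|<\infty$ (i.e. with $f_a=0$). $\mathscr{K}([\vartheta_1,\vartheta_2])$ is the set of functions that vanish outside $[\vartheta_1,\vartheta_2]$ and equal on it a finite sum $\sum_{i,j\geq 0}c_{ij}t^je^{\lambda_i t}$ with $c_{ij},\lambda_i\in\mathbb{C}$. A distributed delay is a causal convolution operator $y=g\ast u$ with kernel $g\in\mathscr{K}([\vartheta_1,\vartheta_2])$ for some reals $0\le\vartheta_1<\vartheta_2$; it is identified with its kernel. For elements of $\mathscr{A}$ the graph topology coincides with the topology of the norm $\|\cdot\|_{\mathscr{A}}$;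 $p\in\mathscr{A}$ can be approximated by a class of elements of $\mathscr{A}$ in the graph topology if for every $\varepsilon>0$ some $p_\varepsilon$ in the class satisfies $\|p-p_\varepsilon\|_{\mathscr{A}}\le\varepsilon$.
   Formalization: The kernel g is assumed not to be the zero function: g = 0 belongs to K([ϑ1,ϑ2]) and equals the purely atomic distribution p = 0, so the claim as worded fails for it. *)

(* Defs.v *)
(* MathComp-Analysis; complex numbers are R[i] from mathcomp-real-closed. *)
From HB Require Import structures.
From mathcomp Require Import all_boot all_order all_algebra.
From mathcomp Require Import all_classical all_reals all_analysis.
From mathcomp.real_closed Require Import complex.

Set Implicit Arguments.
Unset Strict Implicit.
Unset Printing Implicit Defensive.

Import Order.TTheory GRing.Theory Num.Theory.
Import numFieldNormedType.Exports.

Local Open Scope classical_set_scope.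
Local Open Scope ring_scope.
Local Open Scope complex_scope.

Definition cabs (R : realType) (z : R[i]) : R := Normc.normc z.

Definition cexp (R : realType) (z : R[i]) : R[i] :=
  (expR (complex.Re z) * cos (complex.Im z)) +i*
  (expR (complex.Re z) * sin (complex.Im z)).

(* A complex-valued distribution is determined by its values on the real-valued
   test functions, of class C^oo with compact support. *)
Record testfun (R : realType) := TestFun {
  testfun_fun :> R -> R;
  testfun_smooth :
    forall (n : nat) (x : R), derivable (derive1n n testfun_fun) x 1;
  testfun_supp : compact (closure [set x : R | testfun_fun x != 0])
}.

(* Equality of distributions is equality of these functionals; every
   distribution considered below is induced by an L1 function or by an element
   of the algebra, so linearity and continuity hold by construction. *)
Definition schwartz_distribution (R : realType) := testfun R -> R[i].

Definition Rplus (R : realType) : set R := `[0%R, +oo[.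
Arguments Rplus : clear implicits.

Definition L1_pos (R : realType) (f : R -> R[i]) : Prop :=
  [/\ measurable_fun (Rplus R) (fun t : R => complex.Re (f t)),
      measurable_fun (Rplus R) (fun t : R => complex.Im (f t)) &
      (\int[@lebesgue_measure R]_(t in Rplus R) (cabs (f t))%:E < +oo)%E].

Definition distr_of_fun (R : realType) (f : R -> R[i]) : schwartz_distribution R :=
  fun phi =>
    (\int[@lebesgue_measure R]_(t in Rplus R) (complex.Re (f t) * phi t)) +i*
    (\int[@lebesgue_measure R]_(t in Rplus R) (complex.Im (f t) * phi t)).

Definition distr_of_atoms (R : realType) (a : nat -> R[i]) (tm : nat -> R) :
    schwartz_distribution R :=
  fun phi =>
    limn (series (fun n : nat => complex.Re (a n) * phi (tm n))) +i*
    limn (series (fun n : nat => complex.Im (a n) * phi (tm n))).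

(* A decomposition f_a + sum_n f_n delta(t - t_n) of an element of the algebra.
   As a distribution on [0, +oo[, f_a only matters on [0, +oo[, and it is
   determined almost everywhere. *)
Record Aelt (R : realType) := MkAelt {
  A_ac : R -> R[i];
  A_coef : nat -> R[i];
  A_time : nat -> R;
  A_ac_L1 : L1_pos A_ac;
  A_coef_summable : (\sum_(0 <= n <oo) (cabs (A_coef n))%:E < +oo)%E;
  A_time0 : A_time 0%N = 0;
  A_time_incr : forall n : nat, A_time n < A_time n.+1
}.

Definition Adistr (R : realType) (f : Aelt R) : schwartz_distribution R :=
  distr_of_fun (A_ac f) \+ distr_of_atoms (A_coef f) (A_time f).

Definition Anorm (R : realType) (f : Aelt R) : \bar R :=
  (\int[@lebesgue_measure R]_(t in Rplus R) (cabs (A_ac f t))%:E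
   + \sum_(0 <= n <oo) (cabs (A_coef f n))%:E)%E.

Definition purely_atomic (R : realType) : set (Aelt R) :=
  [set p | forall t : R, A_ac p t = 0].

(* d is the element T - p of the algebra: any decomposition of that
   distribution may be used, since the norm does not depend on it. *)
Definition approximable (R : realType) (T : schwartz_distribution R)
    (C : set (Aelt R)) : Prop :=
  forall eps : R, 0 < eps ->
    exists p : Aelt R, C p /\
      exists d : Aelt R,
        Adistr d = T \- Adistr p /\ (Anorm d <= eps%:E)%E.

(* A distributed delay is identified with its kernel, an element of KK. *)
Definition KK (R : realType) (th1 th2 : R) : set (R -> R[i]) :=
  [set g | (forall t : R, ~~ (th1 <= t <= th2) -> g t = 0) /\
    exists (m n : nat) (c : 'I_m -> 'I_n -> R[i]) (lam : 'I_m -> R[i]),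
      forall t : R, th1 <= t <= th2 ->
        g t = \sum_(i < m) \sum_(j < n) c i j * t%:C ^+ j * cexp (lam i * t%:C)].

(* Main.v *)
(* Fix an interval on which the real or the imaginary part of the kernel g has
   constant sign and absolute value at least m > 0. Given a purely atomic p,
   test against a smooth bump on that interval, multiplied by
   1 - exp(- k prod_(i < N) (t - s_i)^2), which vanishes at the N first atoms
   s_i of p. With N large, p sees almost nothing of this test function; with k
   large, the integral of the test function is close to that of the bump, hence
   the pairing with g stays above a constant independent of p. That constant
   bounds the distance from g to p from below, as the test function is at most
   1 in absolute value. *)
Require Import Defs.
From mathcomp Require Import all_boot all_order all_algebra.
From mathcomp Require Import all_classical all_reals all_analysis.
From mathcomp Require Import measurable_realfun.
From mathcomp.real_closed Require Import complex.
From mathcomp Require Import ring lra.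

Local Open Scope ring_scope.
Import Order.TTheory GRing.Theory Num.Theory.
Import numFieldNormedType.Exports.
Set Implicit Arguments.
Unset Strict Implicit.
Unset Printing Implicit Defensive.
Local Open Scope classical_set_scope.

(** * Smooth functions on the real line, closed under differentiation *)

Section Smooth.
Variable R : realType.
Implicit Types (f g : R -> R) (x t : R).

(* [flat 0] is the standard smooth function vanishing exactly on the
   nonpositive reals; [flat n], n > 0, arise in its iterated derivatives. *)
Definition flat (n : nat) (x : R) : R :=
  if 0 < x then x^-1 ^+ n * expR (- x^-1) else 0.

Lemma flat_ge0 n x : 0 <= flat n x.
Proof.
rewrite /flat; case: ifPn => // x0.
by rewrite mulr_ge0 ?expR_ge0// exprn_ge0// invr_ge0 ltW.
Qed.

(** With y = 1/x > 0, the exponential series gives y^(n+2) / (n+2)! <= exp y, that is, y^n exp(-y)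
    <= (n+2)! x^2. This quadratic bound yields the derivative at 0. *)
Lemma flat_le_sqr n x : flat n x <= (n.+2)`!%:R * x ^+ 2.
Proof.
rewrite /flat; case: ifPn => x0; last by rewrite mulr_ge0// ?sqr_ge0.
have y0 : 0 < x^-1 by rewrite invr_gt0.
rewrite expRN -ler_pdivlMr ?invr_gt0 ?expR_gt0// invrK.
have H : x^-1 ^+ n.+2 / (n.+2)`!%:R <= expR x^-1.
  by apply: le_trans (expR_ge1Dxn n.+1 (ltW y0)); rewrite lerDr.
have F0 : 0 < (n.+2)`!%:R :> R by rewrite ltr0n fact_gt0.
move: H; rewrite ler_pdivrMr// => H.
have -> : x^-1 ^+ n = x ^+ 2 * x^-1 ^+ n.+2.
  by rewrite (exprD _ 2 n) mulrA -exprMn mulfV ?gt_eqF// expr1n mul1r.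
rewrite [leRHS](_ : _ = x ^+ 2 * (expR x^-1 * (n.+2)`!%:R)); last by ring.
by rewrite ler_wpM2l ?sqr_ge0.
Qed.

Lemma is_derive_sqr_bound f (C : R) :
  (forall t, `|f t| <= C * t ^+ 2) -> is_derive (0 : R) 1 f 0.
Proof.
move=> fC; have f0 : f 0 = 0.
  by apply/eqP; rewrite -normr_le0 (le_trans (fC 0))// expr0n/= mulr0.
have C0 : 0 <= C by have := fC 1; rewrite expr1n mulr1; exact: le_trans.
have cv : h^-1 *: ((f \o shift 0) (h *: (1:R)) - f 0) @[h --> (0:R)^'] --> (0 : R).
  apply/cvgrPdist_le => e e0; near=> h.
  rewrite sub0r normrN f0 subr0 /= addr0 /GRing.scale/= mulr1 normrM normfV.
  have h0 : 0 < `|h| by rewrite normr_gt0; near: h; exact: nbhs_dnbhs_neq.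
  rewrite mulrC ler_pdivrMr// (le_trans (fC h))//.
  rewrite -[h ^+ 2]ger0_norm ?sqr_ge0// normrX expr2 mulrA ler_wpM2r//.
  (* [C + 1] replaces [C], which may be 0, so that one can divide by it. *)
  rewrite (@le_trans _ _ ((C + 1) * `|h|))//; first by rewrite ler_wpM2r// lerDl.
  rewrite -ler_pdivlMl ?ltr_wpDl//.
  near: h; apply: dnbhs0_le; rewrite mulr_gt0// invr_gt0 ltr_wpDl//.
apply: DeriveDef; first by apply/cvg_ex; exists 0.
exact: cvg_lim cv.
Unshelve. all: by end_near. Qed.

(** Left of 0 the function is locally zero, right of 0 the usual rules apply, and at 0 the quadratic
    bound makes the difference quotient tend to 0. The derivative stays in the span of the family,
    which is why the family carries the index [n]. *)
Lemma is_derive_flat n x :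
  is_derive x 1 (flat n) (flat n.+2 x - n%:R * flat n.+1 x).
Proof.
have [x0|x0|->] := ltgtP x 0.
- rewrite {2 3}/flat ltNge (ltW x0)/= mulr0 subr0.
  apply: (@near_eq_is_derive _ _ _ (cst 0)).
  near=> y; rewrite /flat ltNge; suff -> : y <= 0 by [].
  by apply: ltW; near: y; exact: lt_nbhsl.
- have xn0 : x != 0 by rewrite gt_eqF.
  have dV : is_derive x 1 (fun y : R => y^-1) (- x ^- 2 *: 1).
    exact: is_deriveV.
  have dE : is_derive x 1 (expR \o (fun y : R => - y^-1))
     (expR (- x^-1) * - (- x ^- 2 *: 1)).
    by apply: is_derive1_comp.
  have dX : is_derive x 1 (fun y : R => y^-1 ^+ n) ((n%:R * x^-1 ^+ n.-1) *: (- x ^- 2 *: 1)).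
    rewrite (_ : (fun _ => _) = (fun y : R => y^-1) ^+ n); first exact: is_deriveX.
    by apply/funext => y; rewrite exprfctE.
  have := is_deriveM dX dE.
  move=> /near_eq_is_derive H.
  have -> : flat n.+2 x - n%:R * flat n.+1 x =
    x^-1 ^+ n *: (expR (- x^-1) * - (- x ^- 2 *: 1))
    + (expR \o (fun y => - y^-1)) x *: ((n%:R * x^-1 ^+ n.-1) *: (- x ^- 2 *: 1)).
    rewrite /flat x0 /GRing.scale/=.
    case: n {dX H} => [|n] /=; rewrite -!exprVn ?exprS ?expr0; ring.
  apply: H; near=> y; rewrite /flat; suff -> : 0 < y by [].
  by near: y; exact: lt_nbhsr.
- rewrite {2 3}/flat ltxx mulr0 subr0.
  apply: (@is_derive_sqr_bound _ (n.+2)`!%:R) => t.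
  by rewrite ger0_norm ?flat_ge0// flat_le_sqr.
Unshelve. all: by end_near. Qed.

(** A syntactic class containing the test functions and stable under differentiation: a single
    structural induction then gives derivatives of all orders, with no formula for them. *)
Inductive smooth_expr : (R -> R) -> Prop :=
| smooth_cst c : smooth_expr (fun=> c)
| smooth_id : smooth_expr id
| smoothD f g : smooth_expr f -> smooth_expr g -> smooth_expr (fun x => f x + g x)
| smoothM f g : smooth_expr f -> smooth_expr g -> smooth_expr (fun x => f x * g x)
| smooth_expR f : smooth_expr f -> smooth_expr (fun x => expR (f x))
| smooth_flat n f : smooth_expr f -> smooth_expr (fun x => flat n (f x)).

Lemma smooth_exprN f : smooth_expr f -> smooth_expr (fun x => - f x).
Proof.
move=> sf; rewrite (_ : (fun _ => _) = (fun x => -1 * f x)).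
  by apply: smoothM => //; exact: smooth_cst.
by apply/funext => x; rewrite mulN1r.
Qed.

Lemma smooth_exprB f g :
  smooth_expr f -> smooth_expr g -> smooth_expr (fun x => f x - g x).
Proof. by move=> sf sg; apply: smoothD => //; exact: smooth_exprN. Qed.

Lemma smooth_expr_prod (n : nat) (F : nat -> R -> R) :
  (forall i, smooth_expr (F i)) -> smooth_expr (fun x => \prod_(i < n) F i x).
Proof.
move=> sF; elim: n => [|n IH].
  rewrite (_ : (fun _ => _) = (fun=> 1)); first exact: smooth_cst.
  by apply/funext => x; rewrite big_ord0.
rewrite (_ : (fun _ => _) = (fun x => \prod_(i < n) F i x * F n x)).
  exact: smoothM.
by apply/funext => x; rewrite big_ord_recr.
Qed.

Lemma smooth_expr_is_derive f : smooth_expr f ->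
  exists2 f', smooth_expr f' & forall x, is_derive x 1 f (f' x).
Proof.
elim=> {f} [c||f g _ [f' sf' df] _ [g' sg' dg]|f g sf [f' sf' df] sg [g' sg' dg]
  |f sf [f' sf' df]|n f sf [f' sf' df]].
- by exists (fun=> 0); [exact: smooth_cst|move=> x; exact: is_derive_cst].
- by exists (fun=> 1); [exact: smooth_cst|move=> x; exact: is_derive_id].
- exists (fun x => f' x + g' x); first exact: smoothD.
  by move=> x; exact: is_deriveD.
- exists (fun x => f x * g' x + g x * f' x).
    by apply: smoothD; exact: smoothM.
  by move=> x; exact: is_deriveM.
- exists (fun x => expR (f x) * f' x).
    by apply: smoothM => //; exact: smooth_expR.
  by move=> x; exact: is_derive1_comp.
- exists (fun x => (flat n.+2 (f x) - n%:R * flat n.+1 (f x)) * f' x).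
    apply: smoothM => //; apply: smooth_exprB; first exact: smooth_flat.
    by apply: smoothM; [exact: smooth_cst|exact: smooth_flat].
  by move=> x; apply: is_derive1_comp; exact: is_derive_flat.
Qed.

Lemma smooth_expr_derive1n f n : smooth_expr f -> smooth_expr (f^`(n)).
Proof.
move=> sf; elim: n => [|n]; first by rewrite derive1n0.
move=> /smooth_expr_is_derive[h sh dh]; rewrite derive1nS.
suff -> : (f^`(n))^`() = h by [].
by apply/funext => x; rewrite derive1E; exact: derive_val.
Qed.

Lemma smooth_expr_derivable f x : smooth_expr f -> derivable f x 1.
Proof. by move=> /smooth_expr_is_derive[f' _ /(_ x)[]]. Qed.

Lemma smooth_expr_continuous f : smooth_expr f -> continuous f.
Proof.
move=> sf x; apply: differentiable_continuous.
by apply/derivable1_diffP; exact: smooth_expr_derivable.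
Qed.

End Smooth.

(** * The bump on an interval, its notched versions and their integrals *)

Section Bump.
Variables (R : realType) (a b : R).
Local Notation mu := (@lebesgue_measure R).

Lemma flat0_gt0 (x : R) : (0 < flat 0 x) = (0 < x).
Proof. by rewrite /flat; case: ifPn; rewrite ?ltxx// expr0 mul1r expR_gt0. Qed.

Lemma flat0_le1 (x : R) : flat 0 x <= 1.
Proof.
rewrite /flat; case: ifPn => // x0; rewrite expr0 mul1r.
by rewrite -[leRHS]expR0 ler_expR oppr_le0 invr_ge0 ltW.
Qed.

Definition bump (t : R) : R := flat 0 ((t - a) * (b - t)).

Lemma bump_ge0 t : 0 <= bump t. Proof. exact: flat_ge0. Qed.

Lemma bump_le1 t : bump t <= 1. Proof. exact: flat0_le1. Qed.

(** For b < a the product (t - a)(b - t) would be positive on ]b, a[, hence the assumption a <=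
    b. *)
Lemma bump_out t : ~~ (a < t < b) -> a <= b -> bump t = 0.
Proof.
move=> tab ab; apply/eqP; rewrite eq_le bump_ge0 andbT leNgt flat0_gt0.
apply: contra tab => tab; apply/andP; split; rewrite ltNge; apply/negP => h;
  by have : (t - a) * (b - t) <= 0; [nra|rewrite leNgt tab].
Qed.

Lemma smooth_expr_bump : smooth_expr bump.
Proof.
apply: smooth_flat; apply: smoothM; apply: smooth_exprB;
  by [exact: smooth_id|exact: smooth_cst].
Qed.

(* [bump] with notches of width shrinking with [k] at [s 0, ..., s N.-1]. *)
Definition notched (s : nat -> R) (N k : nat) (t : R) : R :=
  bump t * (1 - expR (- (k%:R * \prod_(i < N) (t - s i) ^+ 2))).

Variables (s : nat -> R) (N : nat).

Lemma notch_itv k (t : R) :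
  0 <= 1 - expR (- (k%:R * \prod_(i < N) (t - s i) ^+ 2)) <= 1.
Proof.
rewrite lerBlDr lerDl expR_ge0 andbT subr_ge0 -[leRHS]expR0 ler_expR oppr_le0.
by rewrite mulr_ge0// prodr_ge0// => i _; rewrite sqr_ge0.
Qed.

Lemma notched_ge0 k t : 0 <= notched s N k t.
Proof. by have /andP[h _] := notch_itv k t; rewrite mulr_ge0// bump_ge0. Qed.

Lemma notched_le_bump k t : notched s N k t <= bump t.
Proof. by have /andP[_ h] := notch_itv k t; rewrite ler_piMr// bump_ge0. Qed.

Lemma notched_out k t : ~~ (a < t < b) -> a <= b -> notched s N k t = 0.
Proof. by move=> tab ab; rewrite /notched bump_out// mul0r. Qed.

Lemma notched_atom k i : (i < N)%N -> notched s N k (s i) = 0.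
Proof.
move=> iN; rewrite /notched (bigD1 (Ordinal iN))//= subrr expr0n/=.
by rewrite mul0r mulr0 oppr0 expR0 subrr mulr0.
Qed.

Lemma smooth_expr_notched k : smooth_expr (notched s N k).
Proof.
apply: smoothM; first exact: smooth_expr_bump.
apply: smooth_exprB; first exact: smooth_cst.
apply: smooth_expR; apply: smooth_exprN; apply: smoothM; first exact: smooth_cst.
apply: (@smooth_expr_prod _ _ (fun i t => (t - s i) ^+ 2)) => i.
apply: (@smoothM _ (fun t => t - s i) (fun t => t - s i));
  by apply: smooth_exprB; [exact: smooth_id|exact: smooth_cst].
Qed.

Lemma notched_supp k : a <= b ->
  compact (closure [set t | notched s N k t != 0]).
Proof.
move=> ab; apply: (@subclosed_compact _ _ `[a, b]) => //.
- exact: closed_closure.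
- exact: segment_compact.
- rewrite [X in _ `<=` X](closure_id _).1; last exact: itv_closed.
  apply: closureS => t /=; apply: contraNT => tab.
  rewrite notched_out//; apply: contra tab => /andP[at_ tb].
  by rewrite in_itv/= !ltW.
Qed.

Definition notched_testfun (ab : a <= b) k : testfun R :=
  TestFun (fun n x => @smooth_expr_derivable _ _ x
             (smooth_expr_derive1n n (smooth_expr_notched k)))
    (@notched_supp k ab).

Lemma smooth_integrable (f : R -> R) : smooth_expr f ->
  mu.-integrable `[a, b] (EFin \o f).
Proof.
move=> sf; apply: continuous_compact_integrable; first exact: segment_compact.
by apply: continuous_subspaceT; exact: smooth_expr_continuous.
Qed.

Lemma notched_cvg t : (forall i, (i < N)%N -> t != s i) ->
  notched s N k t @[k --> \oo] --> bump t.
Proof.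
move=> ts; rewrite /notched -[X in _ --> X]mulr1; apply: cvgMr.
rewrite -[X in _ --> X]subr0; apply: cvgB; first exact: cvg_cst.
set P := \prod_(i < N) _; have P0 : 0 < P.
  apply: prodr_gt0 => i _; rewrite lt_neqAle sqr_ge0 andbT eq_sym sqrf_eq0.
  by rewrite subr_eq0 ts.
(* exp(-kP) is the geometric sequence exp(-P)^k, of ratio below 1 since P > 0. *)
under eq_fun do rewrite -mulrN expRM_natl.
by apply: cvg_expr; rewrite ger0_norm ?expR_ge0// -expR0 ltr_expR oppr_lt0.
Qed.

(** Dominated convergence, with [bump] itself as the dominating function. *)
Lemma Rintegral_notched_cvg :
  \int[mu]_(t in `[a, b]) notched s N k t @[k --> \oo] -->
  \int[mu]_(t in `[a, b]) bump t.
Proof.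
have ib := smooth_integrable smooth_expr_bump.
have [_ _ cv] : [/\ mu.-integrable `[a, b] (EFin \o bump),
  [sequence (\int[mu]_(x in `[a, b]) `|(notched s N n x)%:E - (bump x)%:E|)%E]_n @ \oo --> 0%E &
  [sequence (\int[mu]_(x in `[a, b]) (notched s N n x)%:E)%E]_n @ \oo
     --> (\int[mu]_(x in `[a, b]) (bump x)%:E)%E ].
  apply: (@dominated_convergence _ _ _ mu _ _ _ _ (EFin \o bump)) => //.
  - by move=> k; exact: (measurable_int mu (smooth_integrable (smooth_expr_notched k))).
  - exact: (measurable_int mu ib).
  (* Pointwise convergence is established off the N atoms, a null set. *)
  - have cA : countable (s @` `I_N).
      by apply: finite_set_countable; apply: finite_image; exact: finite_II.
    exists (s @` `I_N); split.
    + exact: countable_measurable.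
    + exact: countable_lebesgue_measure0.
    + move=> t /= ht; apply: contrapT => hs; apply: ht => _.
      apply: cvg_EFin; first exact: nearW.
      apply: notched_cvg => i iN; apply/eqP => tsi; apply: hs.
      by exists i.
  - apply/aeW => t k _; rewrite lee_fin/= ger0_norm ?notched_ge0//.
    exact: notched_le_bump.
rewrite /Rintegral; apply: fine_cvg; rewrite fineK//.
exact: integrable_fin_num ib.
Qed.

Lemma Rintegral_bump_gt0 : a < b -> 0 < \int[mu]_(t in `[a, b]) bump t.
Proof.
(* On the middle half of [a, b] both factors t - a and b - t are at least d, so [bump] is at least
   exp(-1/d^2) there. *)
move=> ab; pose d := (b - a) / 4; pose a' := a + d; pose b' := b - d.
have d0 : 0 < d by rewrite divr_gt0// subr_gt0.
have dE : b - a = 4 * d by rewrite /d mulrC divfK.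
have a'b' : a' < b' by rewrite /a' /b'; lra.
have ib := smooth_integrable smooth_expr_bump.
have sub : `[a', b'] `<=` `[a, b].
  by apply: subset_itv; rewrite bnd_simp /a' /b'; lra.
have ib' : mu.-integrable `[a', b'] (EFin \o bump) by exact: integrableS ib.
pose c := expR (- (d ^+ 2)^-1).
have bc t : `[a', b'] t -> c <= bump t.
  rewrite /= in_itv/= /a' /b' => /andP[h1 h2].
  have dt : d ^+ 2 <= (t - a) * (b - t) by nra.
  have d2 : 0 < d ^+ 2 by rewrite exprn_gt0.
  rewrite /bump /flat (lt_le_trans d2 dt) expr0 mul1r ler_expR lerN2.
  by rewrite lef_pV2// posrE (lt_le_trans d2 dt).
have icst : mu.-integrable `[a', b'] (EFin \o cst c).
  apply: continuous_compact_integrable; first exact: segment_compact.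
  by apply: continuous_subspaceT => x; exact: cst_continuous.
apply: (@lt_le_trans _ _ (\int[mu]_(t in `[a', b']) bump t)).
  apply: (@lt_le_trans _ _ (\int[mu]_(t in `[a', b']) cst c t)).
    rewrite Rintegral_cst//= lebesgue_measure_itv/= lte_fin a'b'.
    by rewrite mulr_gt0 ?expR_gt0//= subr_gt0.
  by apply: le_Rintegral => // x /bc.
rewrite /Rintegral fine_le//; [exact: integrable_fin_num ib'|exact: integrable_fin_num ib|].
apply: ge0_subset_integral => //; first exact: (measurable_int mu ib).
by move=> x _; rewrite lee_fin bump_ge0.
Qed.

End Bump.

(** * Upper and lower bounds on the pairing of a distribution with a test function *)

Section Components.
Variable R : realType.
Local Notation mu := (@lebesgue_measure R).
Implicit Types (z : R[i]) (beta : bool).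

(** The boolean lets one real-valued argument serve both the real and the imaginary part. *)
Definition part beta z : R := if beta then complex.Re z else complex.Im z.

Lemma partD beta z1 z2 : part beta (z1 + z2) = part beta z1 + part beta z2.
Proof. by case: beta z1 z2 => [] [? ?] [? ?]. Qed.

Lemma partB beta z1 z2 : part beta (z1 - z2) = part beta z1 - part beta z2.
Proof. by case: beta z1 z2 => [] [? ?] [? ?]. Qed.

Lemma part0 beta : part beta 0 = 0. Proof. by case: beta. Qed.

Lemma cabs_ge0 z : 0 <= cabs z.
Proof. by case: z => x y; exact: sqrtr_ge0. Qed.

Lemma part_le_cabs beta z : `|part beta z| <= cabs z.
Proof.
case: z => x y; rewrite /cabs /Normc.normc/= -ler_sqr ?nnegrE ?sqrtr_ge0//.
rewrite sqr_sqrtr ?addr_ge0 ?sqr_ge0// -normrX ger0_norm ?sqr_ge0//.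
by case: beta; rewrite /= ?lerDl ?lerDr sqr_ge0.
Qed.

Lemma part_neq0 z : z != 0 -> exists beta, part beta z != 0.
Proof.
case: z => x y; have [->|x0] := eqVneq x 0; last by exists true.
by have [->|y0] := eqVneq y 0; [rewrite eqxx|exists false].
Qed.

Lemma part_distr_of_fun beta (f : R -> R[i]) (phi : testfun R) :
  part beta (distr_of_fun f phi) = \int[mu]_(t in Rplus R) (part beta (f t) * phi t).
Proof. by case: beta. Qed.

Lemma part_distr_of_atoms beta (c : nat -> R[i]) (s : nat -> R) (phi : testfun R) :
  part beta (distr_of_atoms c s phi) =
  limn (series (fun n => part beta (c n) * phi (s n))).
Proof. by case: beta. Qed.

Lemma L1_pos_integrable_cabs (f : R -> R[i]) : L1_pos f ->
  mu.-integrable (Rplus R) (EFin \o (fun t => cabs (f t))).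
Proof.
move=> [mre mim fin]; apply/integrableP; split; last first.
  under eq_integral do rewrite /= ger0_norm ?cabs_ge0//.
  exact: fin.
apply/measurable_EFinP.
(* [L1_pos] gives measurability of the two parts only; that of the modulus comes from its
   formula. *)
rewrite (_ : (fun _ => _) = Num.sqrt \o
  (fun t => complex.Re (f t) ^+ 2 + complex.Im (f t) ^+ 2)); last first.
  by apply/funext => t; rewrite /= /cabs; case: (f t).
apply: measurableT_comp.
  by apply: continuous_measurable_fun; exact: sqrt_continuous.
by apply: measurable_funD; apply: measurable_funX.
Qed.

Lemma L1_pos_measurable_part beta (f : R -> R[i]) : L1_pos f ->
  measurable_fun (Rplus R) (fun t => part beta (f t)).
Proof. by case: beta => -[]. Qed.

Lemma norm_distr_of_fun_le beta (f : R -> R[i]) (phi : testfun R) :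
  L1_pos f -> (forall t, `|phi t| <= 1) -> continuous phi ->
  `|part beta (distr_of_fun f phi)| <=
    fine (\int[mu]_(t in Rplus R) (cabs (f t))%:E).
Proof.
move=> L1f phi1 cphi; rewrite part_distr_of_fun.
have icabs := L1_pos_integrable_cabs L1f.
have bnd t : `|part beta (f t) * phi t| <= cabs (f t).
  by rewrite normrM -[leRHS]mulr1 ler_pM ?part_le_cabs.
have mRp : measurable (Rplus R) by exact: measurable_itv.
have ifp : mu.-integrable (Rplus R) (EFin \o (fun t => part beta (f t) * phi t)).
  apply: le_integrable icabs => //.
    apply/measurable_EFinP; apply: measurable_funM.
      exact: L1_pos_measurable_part.
    by apply: measurable_funTS; exact: continuous_measurable_fun.
  by move=> t _ /=; rewrite lee_fin [leRHS]ger0_norm// cabs_ge0.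
apply: (le_trans (le_normr_Rintegral _ _)) => //.
apply: (@le_Rintegral _ _ _ mu (Rplus R) _ (fun t => cabs (f t))) => //.
by move/integrable_norm : ifp.
Qed.

(** The partial sums of absolute values increase, so a bound from rank N on bounds them all. The
    series then converges absolutely, so [limn] is a true limit and not a default value. *)
Lemma norm_lim_series_le (w : nat -> R) (N : nat) (C : R) :
  (forall n, (N <= n)%N -> \sum_(0 <= k < n) `|w k| <= C) ->
  `|limn (series w)| <= C.
Proof.
move=> wC.
have nd : nondecreasing_seq [normed series w].
  by apply: (@nondecreasing_series _ (fun k => `|w k|) xpredT 0) => *.
have wC' n : [normed series w] n <= C.
  apply: (le_trans (nd _ _ (leq_maxr N n))).
  exact: wC (leq_maxl _ _).
have cv : cvgn [normed series w].
  by apply: nondecreasing_is_cvgn => //; exists C => _ [n _ <-].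
apply: (le_trans (lim_series_norm cv)); apply: limr_le => //.
exact: nearW.
Qed.

Lemma norm_distr_of_atoms_le beta (c : nat -> R[i]) (s : nat -> R) (phi : testfun R) :
  (\sum_(0 <= n <oo) (cabs (c n))%:E < +oo)%E -> (forall t, `|phi t| <= 1) ->
  `|part beta (distr_of_atoms c s phi)| <= fine (\sum_(0 <= n <oo) (cabs (c n))%:E)%E.
Proof.
move=> cfin phi1; rewrite part_distr_of_atoms; apply: (@norm_lim_series_le _ 0) => n _.
have c0 k : (0 <= (cabs (c k))%:E)%E by rewrite lee_fin cabs_ge0.
rewrite -lee_fin fineK ?ge0_fin_numE ?nneseries_ge0//.
apply: le_trans (nneseries_lim_ge n _); last by [].
rewrite sumEFin lee_fin; apply: ler_sum => k _.
by rewrite normrM -[leRHS]mulr1 ler_pM ?part_le_cabs.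
Qed.

(** A test function vanishing at the first N atoms only meets the tail of the coefficients. N
    depends on [c] and [eps] alone, so the test function may be built after N is known. *)
Lemma distr_of_atoms_tail (c : nat -> R[i]) (eps : R) :
  (\sum_(0 <= n <oo) (cabs (c n))%:E < +oo)%E -> 0 < eps ->
  exists N, forall beta (s : nat -> R) (phi : testfun R),
    (forall i, (i < N)%N -> phi (s i) = 0) -> (forall t, `|phi t| <= 1) ->
    `|part beta (distr_of_atoms c s phi)| <= eps.
Proof.
move=> cfin eps0.
have c0 k : (0 <= (cabs (c k))%:E)%E by rewrite lee_fin cabs_ge0.
have /fine_cvgP[fint /cvgrPdist_lt/(_ _ eps0) tl] := nneseries_tail_cvg cfin (fun k _ => c0 k).
(* At this rank the tail sum is both finite and below [eps]; finiteness lets [fine] be removed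
   later. *)
have [N _ /(_ N (leqnn N))[fN tN]] := filterI fint tl.
exists N => beta s phi phis phi1; rewrite part_distr_of_atoms.
apply: (@norm_lim_series_le _ N) => n Nn.
rewrite (big_cat_nat (leq0n N) Nn)/= [X in X + _]big_nat big1 ?add0r; last first.
  by move=> i /andP[_ iN]; rewrite phis// mulr0 normr0.
move: tN => /=; rewrite sub0r normrN ger0_norm; last first.
  by rewrite fine_ge0// nneseries_ge0.
move=> /ltW; apply: le_trans; rewrite -lee_fin fineK//.
apply: le_trans (nneseries_lim_ge n _); last by [].
rewrite sumEFin lee_fin; apply: ler_sum => k _.
by rewrite normrM -[leRHS]mulr1 ler_pM ?part_le_cabs.
Qed.

(** The two summands of [Anorm] bound the pairings of the absolutely continuous and the atomic
    component separately. *)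
Lemma norm_Adistr_le beta (d : Aelt R) (phi : testfun R) (eps : R) :
  (Anorm d <= eps%:E)%E -> (forall t, `|phi t| <= 1) -> continuous phi ->
  `|part beta (Adistr d phi)| <= eps.
Proof.
move=> deps phi1 cphi; rewrite /Adistr/= partD.
apply: (le_trans (ler_normD _ _)).
apply: (le_trans (lerD (norm_distr_of_fun_le beta (A_ac_L1 d) phi1 cphi)
  (norm_distr_of_atoms_le beta (A_time d) (A_coef_summable d) phi1))).
have [_ _ f1] := A_ac_L1 d; have f2 := A_coef_summable d.
rewrite -fineD ?ge0_fin_numE//; first last.
- by apply: nneseries_ge0 => n _ _; rewrite lee_fin cabs_ge0.
- by apply: integral_ge0 => t _; rewrite lee_fin cabs_ge0.
rewrite -lee_fin fineK// fin_numD !ge0_fin_numE ?f1 ?f2//.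
- by apply: nneseries_ge0 => n _ _; rewrite lee_fin cabs_ge0.
- by apply: integral_ge0 => t _; rewrite lee_fin cabs_ge0.
Qed.

(** As [x] keeps its sign on [a, b] and [phi] is nonnegative, nothing cancels in the integral. The
    continuous [x] stands in for the component of [f], which may jump outside [a, b] or at its
    ends. *)
Lemma norm_distr_of_fun_ge beta (f : R -> R[i]) (x : R -> R) (a b m : R)
  (phi : testfun R) :
  0 <= a -> continuous x -> continuous phi -> (forall t, 0 <= phi t) ->
  (forall t, ~~ (a < t < b) -> phi t = 0) ->
  (forall t, a <= t <= b -> part beta (f t) = x t) ->
  (forall t, a <= t <= b -> m <= x t) \/ (forall t, a <= t <= b -> m <= - x t) ->
  m * \int[mu]_(t in `[a, b]) phi t <= `|part beta (distr_of_fun f phi)|.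
Proof.
move=> a0 cx cphi phi0 phiout fx mx; rewrite part_distr_of_fun.
(* [a, b] lies in the half-line since 0 <= a, and [phi] vanishes outside ]a, b[. *)
have -> : \int[mu]_(t in Rplus R) (part beta (f t) * phi t) =
    \int[mu]_(t in `[a, b]) (x t * phi t).
  rewrite Rintegral_mkcond [RHS]Rintegral_mkcond; apply: eq_Rintegral => t _.
  rewrite /patch; case: (boolP (t \in `[a, b]%classic)) => tab.
    move: tab; rewrite inE/= in_itv/= => /andP[at_ tb].
    have Rt : t \in Rplus R by rewrite inE /Rplus/= in_itv/= andbT (le_trans a0).
    by rewrite Rt fx// at_.
  case: ifP => // _; rewrite phiout ?mulr0//; apply: contra tab => /andP[? ?].
  by rewrite inE/= in_itv/= !ltW.
have ci (y : R -> R) : continuous y -> mu.-integrable `[a, b] (EFin \o y).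
  move=> cy; apply: continuous_compact_integrable; first exact: segment_compact.
  exact: continuous_subspaceT.
have cxp : continuous (fun t => x t * phi t).
  by move=> t; apply: cvgM; [exact: cx|exact: cphi].
have ixp := ci _ cxp.
have iphi := ci _ cphi.
have imp : mu.-integrable `[a, b] (EFin \o (fun t => m * phi t)).
  by apply: ci => t; apply: cvgMr; exact: cphi.
rewrite -RintegralZl//; case: mx => mx.
- apply: le_trans (ler_norm _); apply: le_Rintegral => // t.
  by rewrite /= in_itv/= => /mx ?; rewrite ler_wpM2r.
(* For negative sign, the opposite of the integral is bounded below. *)
- rewrite -normrN; apply: le_trans (ler_norm _).
  rewrite -mulN1r -RintegralZl//; apply: le_Rintegral => //.
    by apply: ci => t; apply: cvgMr; exact: cxp.
  by move=> t; rewrite /= in_itv/= => /mx ?; rewrite mulN1r -mulNr ler_wpM2r.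
Qed.

(** The order of quantifiers matters: [eps] depends on a, b and m only, whereas [phi] is adapted to
    the atoms. The factor 2 leaves room for one [eps] from the atoms and one from the approximation
    error. *)
Lemma atom_avoiding_testfun (a b m : R) : a < b -> 0 < m ->
  exists2 eps, 0 < eps & forall (c : nat -> R[i]) (s : nat -> R),
    (\sum_(0 <= n <oo) (cabs (c n))%:E < +oo)%E ->
    exists phi : testfun R, [/\ continuous phi, forall t, 0 <= phi t <= 1,
      forall t, ~~ (a < t < b) -> phi t = 0,
      forall beta, `|part beta (distr_of_atoms c s phi)| <= eps &
      2 * eps < m * \int[mu]_(t in `[a, b]) phi t].
Proof.
move=> ab m0; pose I := \int[mu]_(t in `[a, b]) bump a b t.
have I0 : 0 < I by exact: Rintegral_bump_gt0.
have e0 : 0 < m * I / 3 by rewrite divr_gt0// mulr_gt0.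
exists (m * I / 3) => // c s cfin.
have [N tailN] := distr_of_atoms_tail cfin e0.
(* Choosing k so that the notches cost less than a third of I gives 2 [eps] = m (2/3) I < m times
   the integral of [phi]. *)
have lt23 : 2 / 3 * I < I by lra.
have /cvgr_gt/(_ _ lt23)[k _ /(_ k (leqnn k)) /= Ik] := @Rintegral_notched_cvg R a b s N.
exists (notched_testfun s N (ltW ab) k); split => /=.
- exact/smooth_expr_continuous/smooth_expr_notched.
- by move=> t; rewrite notched_ge0 (le_trans (notched_le_bump _ _ _ _ _ _))// bump_le1.
- by move=> t tab; rewrite notched_out// ltW.
- move=> beta; apply: tailN => [i iN|t] /=.
    exact: notched_atom.
  by rewrite ger0_norm ?notched_ge0// (le_trans (notched_le_bump _ _ _ _ _ _))// bump_le1.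
- by rewrite [ltLHS](_ : _ = m * (2 / 3 * I)) ?ltr_pM2l//; field.
Qed.

End Components.

(** * Continuity of exponential polynomials and intervals of constant sign *)

Section Kernel.
Variable R : realType.

(** Continuity is stated through real components, so no topology on the complex numbers is
    involved. *)
Definition parts_continuous (F : R -> R[i]) : Prop :=
  forall beta, continuous (fun t => part beta (F t)).

Lemma parts_continuousD F G : parts_continuous F -> parts_continuous G ->
  parts_continuous (fun t => F t + G t).
Proof.
move=> cF cG beta; under eq_fun do rewrite partD.
by move=> t; apply: cvgD; [exact: cF|exact: cG].
Qed.

Lemma parts_continuousM F G : parts_continuous F -> parts_continuous G ->
  parts_continuous (fun t => F t * G t).
Proof.
move=> cF cG [].
- rewrite (_ : (fun _ => _) = (fun t =>
      part true (F t) * part true (G t) - part false (F t) * part false (G t))).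
    by move=> t; apply: cvgB; apply: cvgM; first [exact: cF|exact: cG].
  by apply/funext => t; case: (F t) (G t) => [? ?] [? ?].
- rewrite (_ : (fun _ => _) = (fun t =>
      part true (F t) * part false (G t) + part false (F t) * part true (G t))).
    by move=> t; apply: cvgD; apply: cvgM; first [exact: cF|exact: cG].
  by apply/funext => t; case: (F t) (G t) => [? ?] [? ?].
Qed.

Lemma parts_continuous_cst z : parts_continuous (fun=> z).
Proof. by move=> beta t; exact: cvg_cst. Qed.

Lemma parts_continuous_real : parts_continuous (fun t => t%:C%C).
Proof. by case=> t; [exact: cvg_id|exact: cvg_cst]. Qed.

Lemma parts_continuous_cexp F : parts_continuous F ->
  parts_continuous (fun t => cexp (F t)).
Proof.
move=> cF.
have cE : continuous (fun t => expR (complex.Re (F t))).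
  by move=> t; apply: continuous_comp; [exact: (cF true)|exact: continuous_expR].
case=> t; apply: cvgM; first [exact: cE
  |apply: continuous_comp; [exact: (cF false)|exact: continuous_cos]
  |apply: continuous_comp; [exact: (cF false)|exact: continuous_sin]].
Qed.

Lemma parts_continuous_sum n (F : 'I_n -> R -> R[i]) :
  (forall i, parts_continuous (F i)) ->
  parts_continuous (fun t => \sum_(i < n) F i t).
Proof.
elim: n F => [|n IH] F cF.
  by under eq_fun do rewrite big_ord0; exact: parts_continuous_cst.
under eq_fun do rewrite big_ord_recr/=.
by apply: parts_continuousD; [apply: IH|exact: cF].
Qed.

Lemma parts_continuousX F n : parts_continuous F ->
  parts_continuous (fun t => F t ^+ n).
Proof.
move=> cF; elim: n => [|n IH]; first exact: parts_continuous_cst.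
by under eq_fun do rewrite exprS; exact: parts_continuousM.
Qed.

(** The kernel may jump at [th1] and [th2]; the formula it follows between them is continuous on the
    whole line. *)
Lemma KK_parts_continuous (th1 th2 : R) (g : R -> R[i]) : KK th1 th2 g ->
  exists2 G, parts_continuous G & forall t, th1 <= t <= th2 -> g t = G t.
Proof.
move=> [_ [m [n [c [lam gE]]]]].
exists (fun t => \sum_(i < m) \sum_(j < n) c i j * (t%:C)%C ^+ j * cexp (lam i * (t%:C)%C)) => //.
apply: parts_continuous_sum => i; apply: parts_continuous_sum => j.
apply: parts_continuousM.
  apply: parts_continuousM; first exact: parts_continuous_cst.
  apply: parts_continuousX; exact: parts_continuous_real.
apply: parts_continuous_cexp; apply: parts_continuousM.
  exact: parts_continuous_cst.
exact: parts_continuous_real.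
Qed.

Lemma continuous_neq0_itv (x : R -> R) (th1 th2 t0 : R) :
  continuous x -> th1 < th2 -> th1 <= t0 <= th2 -> x t0 != 0 ->
  exists a b m, [/\ th1 <= a, a < b, b <= th2, 0 < m &
    (forall t, a <= t <= b -> m <= x t) \/ (forall t, a <= t <= b -> m <= - x t)].
Proof.
move=> cx th12 /andP[t01 t02] x0; pose m := `|x t0| / 2.
have m0 : 0 < m by rewrite divr_gt0// normr_gt0.
have xE : `|x t0| = 2 * m by rewrite /m mulrC divfK.
have /cvgrPdist_lt/(_ _ m0)/nbhs_ballP[d /= d0 xd] := cx t0.
(* Clipping to [th1, th2] handles a [t0] at an endpoint, and d / 2 keeps the closed interval inside
   the open ball of radius d. *)
pose a := Num.max th1 (t0 - d / 2); pose b := Num.min th2 (t0 + d / 2).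
have xm t : a <= t <= b -> `|x t0 - x t| < m.
  rewrite ge_max le_min => /andP[/andP[_ h1] /andP[_ h2]].
  by apply: xd; rewrite /ball/= ltr_norml; apply/andP; split; lra.
exists a, b, m; split => //.
- by rewrite le_max lexx.
- by rewrite gt_max !lt_min th12/=; apply/and3P; split; lra.
- by rewrite ge_min lexx.
have [x0p|x0n] := leP 0 (x t0); [left|right] => t /xm; rewrite ltr_norml => /andP[h1 h2].
- by move: xE; rewrite ger0_norm// => xE; lra.
- by move: xE; rewrite ltr0_norm// => xE; lra.
Qed.

End Kernel.

(** The zero kernel is purely atomic, with all coefficients 0, and thus approximable; [hg0] excludes
    it. *)
Theorem theorem2 (R : realType) (th1 th2 : R) (h1 : 0 <= th1) (h12 : th1 < th2)
  (g : R -> complex R) (hg : KK th1 th2 g) (hg0 : exists t : R, g t != 0) :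
  ~ approximable (distr_of_fun g) (@purely_atomic R).
Proof.
move=> approx; have [t0 gt0] := hg0.
have t0th : th1 <= t0 <= th2.
  by apply: contraNT gt0 => /(proj1 hg) ->.
have [G cG gG] := KK_parts_continuous hg.
have [beta Gb0] : exists beta, part beta (G t0) != 0.
  by apply: part_neq0; rewrite -gG.
have [a [b [m [tha ab bth m0 Gm]]]] := continuous_neq0_itv (cG beta) h12 t0th Gb0.
have [eps eps0 avoid] := atom_avoiding_testfun ab m0.
have [p [p0 [d [dE deps]]]] := approx _ eps0.
have [phi [cphi phi01 phiout atoms mphi]] := avoid _ (A_time p) (A_coef_summable p).
have phi0 t : 0 <= phi t by have /andP[] := phi01 t.
have phi1 t : `|phi t| <= 1 by have /andP[? ?] := phi01 t; rewrite ger0_norm.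
have ac0 : part beta (distr_of_fun (A_ac p) phi) = 0.
  rewrite part_distr_of_fun (@eq_Rintegral _ _ _ _ _ (cst 0)).
    by rewrite Rintegral_cst ?mul0r//; exact: measurable_itv.
  by move=> t _; rewrite p0 part0 mul0r.
(* Since [d] represents g - p and p has no absolutely continuous part, pairing g with [phi] is
   pairing [d] plus the atoms of p. *)
have gE : part beta (distr_of_fun g phi) =
    part beta (Adistr d phi) + part beta (distr_of_atoms (A_coef p) (A_time p) phi).
  have -> : Adistr d phi = distr_of_fun g phi - Adistr p phi by rewrite dE.
  by rewrite partB [Adistr p phi]/Adistr/= partD ac0 add0r subrK.
have lb := @norm_distr_of_fun_ge R beta g (fun t => part beta (G t)) a b m phi
  (le_trans h1 tha) (cG beta) cphi phi0 phiout.
(* Each of the two terms of [gE] is at most [eps], against [mphi]. *)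
have : m * \int[@lebesgue_measure R]_(t in `[a, b]) phi t <= 2 * eps.
  apply: le_trans (lb _ Gm) _.
    by move=> t /andP[at_ tb]; rewrite gG// (le_trans tha)// (le_trans tb).
  rewrite gE mulr_natl mulr2n (le_trans (ler_normD _ _))// lerD//.
  exact: norm_Adistr_le.
by rewrite leNgt mphi.
Qed.
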